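(* Let $\mathcal{X}=\{\mathbf{x}(s):s\in\mathcal{S}\}\subset\mathbb{R}^m$ be the finite set of state-feature vectors of a finite MDP with finite action set $\mathcal{A}$, let $\gamma\in[0,1)$, let $\pi$ be a policy, let $\zeta$ be a probability distribution on $\mathcal{X}$, and let $\hat{\mathbf{x}}:\mathcal{X}\times\mathcal{A}\to\mathbb{R}^m$, $\hat r:\mathcal{X}\times\mathcal{A}\to\mathbb{R}$ be an arbitrary expectation model. Let $\{\boldsymbol\phi_k\}_{k\ge 0}$ be i.i.d. with distribution $\zeta$, with $A_k\sim\pi(\cdot\mid\boldsymbol\phi_k)$, and let $\{\mathbf{w}_k\},\{\mathbf{V}_k\}$ be produced by the Gradient Dyna iteration $$\mathbf{w}_{k+1}=\mathbf{w}_k-\alpha_k\,\mathbf{V}_k\,\Delta_k\,\boldsymbol\phi_k,\qquad \mathbf{V}_{k+1}=\mathbf{V}_k+\beta_k\bigl((\gamma\hat{\mathbf{x}}(\boldsymbol\phi_k,A_k)-\boldsymbol\phi_k)\boldsymbol\phi_k^\top-\mathbf{V}_k\boldsymbol\phi_k\boldsymbol\phi_k^\top\bigr),$$ where $\Delta_k=\hat r(\boldsymbol\phi_k,A_k)+\gamma\mathbf{w}_k^\top\hat{\mathbf{x}}(\boldsymbol\phi_k,A_k)-\mathbf{w}_k^\top\boldsymbol\phi_k$, started from given $\mathbf{w}_0\in\mathbb{R}^m$ and $\mathbf{V}_0\in\mathbb{R}^{m\times m}$. Suppose that 1. the sequence $\{\boldsymbol\phi_k\}$ is bounded, the matrix $\mathbb{E}_\zeta[\boldsymbol\phi_k\boldsymbol\phi_k^\top]$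 is non-singular, and the matrix $\mathbf{A}=\mathbb{E}_\zeta[\boldsymbol\phi_k(\boldsymbol\phi_k-\gamma\hat{\mathbf{x}}(\boldsymbol\phi_k,A_k))^\top]$ is non-singular; 2. the (deterministic) step sizes satisfy $\alpha_k>0$, $\beta_k>0$, $\sum_{k=0}^\infty\alpha_k=\infty$, $\sum_{k=0}^\infty\beta_k=\infty$, $\sum_{k=0}^\infty\alpha_k^2<\infty$, $\sum_{k=0}^\infty\beta_k^2<\infty$. Then for any initial weight vector $\mathbf{w}_0$, $\lim_{k\to\infty}\mathbf{w}_k=\mathbf{w}^*$ with probability 1, where $\mathbf{w}^*=\mathbf{A}^{-1}\mathbf{c}$ and $\mathbf{c}=\mathbb{E}_\zeta[\hat r(\boldsymbol\phi_k,A_k)\boldsymbol\phi_k]$.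
   Context: $\mathcal{S}$ is the finite state set and $\mathbf{x}:\mathcal{S}\to\mathbb{R}^m$ the feature mapping. A policy $\pi(a\mid\boldsymbol\phi)\in[0,1]$ gives, for each feature vector $\boldsymbol\phi$, a probability distribution over actions $a\in\mathcal{A}$. The pairs $(\boldsymbol\phi_k,A_k)$ are i.i.d. over $k$, with $\boldsymbol\phi_k\sim\zeta$ and $A_k\sim\pi(\cdot\mid\boldsymbol\phi_k)$; $\mathbb{E}_\zeta[\cdot]$ denotes expectation with respect to this law. An expectation model is a pair of functions $\{\hat{\mathbf{x}},\hat r\}$ taking a feature vector and an action to (an approximation of) the expected next feature vector and expected reward; no accuracy is assumed. The vector $\mathbf{w}^*$ is the unique minimizer of the Model-Based Mean Square Projected Bellman Error $\text{MB-MSPBE}(\mathbf{w})=\mathbb{E}_\zeta[\Delta_k(\mathbf{w})\boldsymbol\phi_k]^\top\,\mathbb{E}_\zeta[\boldsymbol\phi_k\boldsymbol\phi_k^\top]^{-1}\,\mathbb{E}_\zeta[\Delta_k(\mathbf{w})\boldsymbol\phi_k]$, where $\Delta_k(\mathbf{w})=\hat r(\boldsymbol\phi_k,A_k)+\gamma\mathbf{w}^\top\hat{\mathbf{x}}(\boldsymbol\phi_k,A_k)-\mathbf{w}^\top\boldsymbol\phi_k$. *)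

(* Defs.v *)
From HB Require Import structures.
From mathcomp Require Import all_boot all_order all_algebra finmap.
From mathcomp Require Import all_classical all_reals all_analysis.

Set Implicit Arguments.
Unset Strict Implicit.
Unset Printing Implicit Defensive.

Import Order.TTheory GRing.Theory Num.Theory.
Import numFieldNormedType.Exports.

Local Open Scope classical_set_scope.
Local Open Scope ring_scope.

(* Coerced to a type, [feature_set x] is the finite type of the vectors [x s]:
   states with equal features give the same element, and [val] recovers the
   vector itself. *)
Definition feature_set (R : realType) (m : nat) (S : finType)
  (x : S -> 'cV[R]_m) : {fset 'cV[R]_m} := [fset x s | s in S]%fset.

Definition is_pmf (R : realType) (T : finType) (p : T -> R) : Prop :=
  (forall t, 0 <= p t) /\ \sum_t p t = 1.

Section RandomElements.
Context (R : realType) (d : measure_display) (Omega : measurableType d)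
  (P : probability Omega R) (T : finType).

(* Measurability for the discrete sigma-algebra on [T]. *)
Definition random_element (Z : Omega -> T) : Prop :=
  forall B : set T, measurable (Z @^-1` B).

Definition has_pmf (p : T -> R) (Z : Omega -> T) : Prop :=
  forall t, P (Z @^-1` [set t]) = (p t)%:E.

Definition mutually_independent (Z : nat -> Omega -> T) : Prop :=
  forall (I : {fset nat}) (B : nat -> set T),
    P (\bigcap_(k in [set` I]) (Z k @^-1` B k)) =
    (\prod_(k <- I) P (Z k @^-1` B k))%E.

Definition iid_with_pmf (p : T -> R) (Z : nat -> Omega -> T) : Prop :=
  [/\ forall k, random_element (Z k),
      forall k, has_pmf p (Z k) &
      mutually_independent Z].

End RandomElements.

Definition is_unique_minimizer (R : realType) (T : Type) (f : T -> R) (u : T)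
  : Prop :=
  (forall w, f u <= f w) /\ (forall w, (forall w', f w <= f w') -> w = u).

Definition dotv (R : realType) (m : nat) (u v : 'cV[R]_m) : R :=
  (u^T *m v) 0 0.

Section GradientDyna.
Context (R : realType) (m : nat) (X : {fset 'cV[R]_m}) (Act : finType).
Context (gamma : R) (xhat : X -> Act -> 'cV[R]_m) (rhat : X -> Act -> R).

Definition td_error (w : 'cV[R]_m) (phi : X) (a : Act) : R :=
  rhat phi a + gamma * dotv w (xhat phi a) - dotv w (val phi).

Section Expectation.
Context (zeta : X -> R) (pi : X -> Act -> R).

(* The law of (phi, A) when phi ~ zeta and A ~ pi(. | phi). *)
Definition joint_pmf (z : X * Act) : R := zeta z.1 * pi z.1 z.2.

Definition expect (V : lmodType R) (f : X -> Act -> V) : V :=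
  \sum_(z : X * Act) joint_pmf z *: f z.1 z.2.

Definition second_moment : 'M[R]_m :=
  expect (fun phi _ => val phi *m (val phi)^T).

Definition A_matrix : 'M[R]_m :=
  expect (fun phi a => val phi *m (val phi - gamma *: xhat phi a)^T).

Definition c_vector : 'cV[R]_m :=
  expect (fun phi a => rhat phi a *: val phi).

Definition MB_MSPBE (w : 'cV[R]_m) : R :=
  let g := expect (fun phi a => td_error w phi a *: val phi) in
  (g^T *m invmx second_moment *m g) 0 0.

End Expectation.

Fixpoint gradient_dyna (alpha beta : nat -> R) (phi : nat -> X)
  (a : nat -> Act) (w0 : 'cV[R]_m) (V0 : 'M[R]_m) (k : nat)
  : 'cV[R]_m * 'M[R]_m :=
  if k is k'.+1 then
    let: (w, V) := gradient_dyna alpha beta phi a w0 V0 k' in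
    let f := val (phi k') in
    (w - alpha k' *: (V *m (td_error w (phi k') (a k') *: f)),
     V + beta k' *: ((gamma *: xhat (phi k') (a k') - f) *m f^T
                     - V *m (f *m f^T)))
  else (w0, V0).

End GradientDyna.

(* Main.v *)
Require Import Defs.
From HB Require Import structures.
From mathcomp Require Import all_boot all_order all_algebra finmap.
From mathcomp Require Import all_classical all_reals all_analysis.
From mathcomp Require Import lra ring.

Set Implicit Arguments.
Unset Strict Implicit.
Unset Printing Implicit Defensive.

Import Order.TTheory GRing.Theory Num.Theory.
Import numFieldNormedType.Exports.

Local Open Scope classical_set_scope.
Local Open Scope ring_scope.

(** The matrix iterate is a linear stochastic approximation on its own, with
limit [Vstar = - A^T G^-1] where [G] is the second moment of the features; the
mean field of the weights at [Vstar] is [- A^T G^-1 A (w - wstar)], a descent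
direction for [|w - wstar|^2] because [A^T G^-1 A] is positive definite.  Hence
[Y = |V - Vstar|^2], as well as [Y = |w - wstar|^2] killed at the first time
after [N] when [|V - Vstar|^2] exceeds a fixed small [eps], satisfies
[E_k Y_(k+1) <= (1 - mu a_k + C a_k^2) Y_k + C a_k^2].  Such a [Y] tends to [0]
almost surely: [Y_k + C sum_(j >= k) a_j^2] is eventually a nonnegative
supermartingale, its means have lower limit [0] since [sum a_k] diverges, and
Ville's maximal inequality turns small means into small probabilities.  As
[V] converges, almost every path escapes the killing for some [N].

The samples take finitely many values, so conditional expectations are finite
sums over the children of a node in the tree of sample histories. *)

(** * Supermartingales on the tree of histories *)

Section IteratedMean.
Context (R : realType) (T : finType) (p : T -> R).

Definition next_mean (F : seq T -> R) (h : seq T) : R :=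
  \sum_s p s * F (rcons h s).

(** Conditional expectation of [F] after [n] more samples, given the history [h]. *)
Fixpoint mean (n : nat) (F : seq T -> R) (h : seq T) : R :=
  if n is n'.+1 then \sum_s p s * mean n' F (rcons h s) else F h.

(** [mean] unfolds the first step; this tower property peels off the last one, as an induction on
    time requires. *)
Lemma mean_next (n : nat) (F : seq T -> R) (h : seq T) :
  mean n (next_mean F) h = mean n.+1 F h.
Proof.
elim: n h => [//|n IHn] h.
by rewrite [LHS]/=; apply: eq_bigr => s _; rewrite IHn.
Qed.

Hypothesis p_pmf : is_pmf p.

(** Only histories of the depth reached are compared, so a term depending on the depth alone can be
    averaged like a constant. *)
Lemma le_mean (n : nat) (F G : seq T -> R) (h : seq T) :
  (forall h', size h' = (size h + n)%N -> F h' <= G h') ->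
  mean n F h <= mean n G h.
Proof.
elim: n h => [|n IHn] h FG /=; first by apply: FG; rewrite addn0.
apply: ler_sum => s _; apply: ler_wpM2l; first exact: p_pmf.1.
by apply: IHn => h' h'E; apply: FG; rewrite h'E size_rcons addSnnS.
Qed.

Lemma eq_mean (n : nat) (F G : seq T -> R) (h : seq T) :
  (forall h', size h' = (size h + n)%N -> F h' = G h') ->
  mean n F h = mean n G h.
Proof.
move=> FG; apply/eqP; rewrite eq_le.
by apply/andP; split; apply: le_mean => h' /FG ->.
Qed.

Lemma mean_affine (n : nat) (a b : R) (F G : seq T -> R) (h : seq T) :
  mean n (fun h' => a * F h' + b * G h') h = a * mean n F h + b * mean n G h.
Proof.
elim: n h => [//|n IHn] h /=.
rewrite !mulr_sumr -big_split /=; apply: eq_bigr => s _.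
by rewrite IHn; ring.
Qed.

Lemma mean_cst (n : nat) (c : R) (h : seq T) : mean n (fun=> c) h = c.
Proof.
elim: n h => [//|n IHn] h /=; under eq_bigr do rewrite IHn.
by rewrite -mulr_suml p_pmf.2 mul1r.
Qed.

Lemma mean_ge0 (n : nat) (F : seq T -> R) (h : seq T) :
  (forall h', 0 <= F h') -> 0 <= mean n F h.
Proof. by move=> F0; rewrite -(mean_cst n 0 h); apply: le_mean => h' _. Qed.

End IteratedMean.

(** * Ville's maximal inequality and almost sure convergence *)

Section Ville.
Context (R : realType) (d : measure_display) (Omega : measurableType d)
  (P : probability Omega R) (T : finType) (p : T -> R) (Z : nat -> Omega -> T).

Definition history (n : nat) (omega : Omega) : seq T := mkseq (Z^~ omega) n.

Lemma historyS (n : nat) (omega : Omega) :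
  history n.+1 omega = rcons (history n omega) (Z n omega).
Proof. exact: mkseqS. Qed.

Lemma size_history (n : nat) (omega : Omega) : size (history n omega) = n.
Proof. exact: size_mkseq. Qed.

Lemma take_history (m n : nat) (omega : Omega) : (m <= n)%N ->
  take m (history n omega) = history m omega.
Proof.
by move=> mn; rewrite /history /mkseq -map_take take_iota (minn_idPl mn).
Qed.

Lemma bigsetU_finType (I : finType) (F : I -> set Omega) :
  \big[setU/set0]_i F i = \bigcup_i F i.
Proof.
rewrite -bigcup_seq; apply/seteqP; split => omega [i _ Fi]; exists i => //=.
by rewrite mem_index_enum.
Qed.

Lemma measure_bigsetU_le (I : Type) (r : seq I) (F : I -> set Omega) :
  (forall i, measurable (F i)) ->
  (P (\big[setU/set0]_(i <- r) F i) <= \sum_(i <- r) P (F i))%E.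
Proof.
move=> mF; elim: r => [|i r IHr]; first by rewrite !big_nil measure0.
rewrite !big_cons; apply: le_trans (leeD (lexx _) IHr).
by apply: measureU2 => //; exact: bigsetU_measurable.
Qed.

Hypothesis p_pmf : is_pmf p.
Hypothesis Z_iid : iid_with_pmf P p Z.

Lemma measurable_history (n : nat) (Q : set (seq T)) :
  measurable (history n @^-1` Q).
Proof.
elim: n Q => [|n IHn] Q.
  have [Q0|nQ0] := pselect (Q [::]).
    by rewrite (_ : _ @^-1` _ = setT) //; apply/seteqP; split.
  by rewrite (_ : _ @^-1` _ = set0) //; apply/seteqP; split.
rewrite (_ : _ @^-1` _ = \big[setU/set0]_(s : T)
  (Z n @^-1` [set s] `&` history n @^-1` [set h | Q (rcons h s)])).
  apply: bigsetU_measurable => s _; apply: measurableI; last exact: IHn.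
  by case: Z_iid => mZ _ _; exact: mZ.
rewrite bigsetU_finType; apply/seteqP; split => omega /=; rewrite historyS.
  by move=> QZ; exists (Z n omega).
by move=> [s _ /= [<-]].
Qed.

Lemma prob_history (h : seq T) :
  P (history (size h) @^-1` [set h]) = (\prod_(s <- h) p s)%:E.
Proof.

case: Z_iid => _ Zp indep.
(* A nonempty history supplies the default value [s0] for [nth]. *)
case: h => [|s0 h].
  rewrite big_nil (_ : _ @^-1` _ = setT) ?probability_setT //.
  by apply/seteqP; split.

have : (0 < size (s0 :: h))%N by [].
move: (s0 :: h) => {}h h_gt0; set n := size h in h_gt0 *.
have [J JE] : exists J : {fset nat}, J =i iota 0 n.
  by exists (seq_fset tt (iota 0 n)) => k; rewrite seq_fsetE.
have -> : history n @^-1` [set h] =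
    \bigcap_(k in [set` J]) (Z k @^-1` [set nth s0 h k]).
  apply/seteqP; split => omega /=.
    move=> hE k /=; rewrite JE mem_iota add0n => kn.
    by rewrite -{1}hE nth_mkseq.
  move=> Zh; apply: (@eq_from_nth _ s0); rewrite size_history // => k kn.
  by rewrite nth_mkseq //; apply: Zh; rewrite /= JE mem_iota.
rewrite indep (perm_big (iota 0 n)) /=; last first.
  by apply: uniq_perm; rewrite ?iota_uniq ?fset_uniq.
under eq_bigr do rewrite Zp.
by rewrite prodEFin (big_nth s0) /index_iota subn0.
Qed.

(** The finite window makes the event depend on a history of bounded length; [n] is sent to infinity
    in [ville]. *)
Definition hit (K : seq T -> R) (lambda : R) (i n : nat) : set Omega :=
  [set omega | exists2 m, (i <= m <= i + n)%N & lambda <= K (history m omega)].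

Lemma measurable_hit K lambda i n : measurable (hit K lambda i n).
Proof.
rewrite (_ : hit _ _ _ _ = history (i + n) @^-1` [set h |
  exists2 m, (i <= m <= i + n)%N & lambda <= K (take m h)]).
  exact: measurable_history.
apply/seteqP; split => omega /= [m /andP[im mn] Km]; exists m; rewrite ?im //.
  by rewrite take_history.
by rewrite take_history in Km.
Qed.

Section Supermartingale.
Variables (K : seq T -> R) (k : nat) (lambda : R).
Hypothesis lambda_gt0 : 0 < lambda.
Hypothesis K_ge0 : forall h, 0 <= K h.
Hypothesis K_super : forall h, (k <= size h)%N -> next_mean p K h <= K h.

Let weight (h : seq T) : R := \prod_(s <- h) p s.

Let weight_ge0 h : 0 <= weight h.
Proof. by apply: prodr_ge0 => s _; exact: p_pmf.1. Qed.

Let measurable_start (h : seq T) (A : set Omega) :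
  measurable A -> measurable (history (size h) @^-1` [set h] `&` A).
Proof. by move=> mA; apply: measurableI => //; exact: measurable_history. Qed.

(** Split on the next sample: the child reached by [s] has weight [weight h * p s], so bounds at the
    children average to a bound at [h]. *)
Let start_split (h : seq T) (A : set Omega) (c : seq T -> R) :
  measurable A ->
  (forall s, (P (history (size (rcons h s)) @^-1` [set rcons h s] `&` A)
    <= (weight (rcons h s) * c (rcons h s) / lambda)%:E)%E) ->
  (P (history (size h) @^-1` [set h] `&` A)
    <= (weight h * next_mean p c h / lambda)%:E)%E.
Proof.
move=> mA cP.
have sub : history (size h) @^-1` [set h] `&` A `<=` \big[setU/set0]_(s : T)
    (history (size (rcons h s)) @^-1` [set rcons h s] `&` A).
  rewrite bigsetU_finType => omega [/= hE Ao]; exists (Z (size h) omega) => //.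
  by split => //=; rewrite size_rcons historyS hE.
apply: (@le_trans _ _ (\sum_(s : T)
    P (history (size (rcons h s)) @^-1` [set rcons h s] `&` A))).
  apply: le_trans (measure_bigsetU_le _ _) => [|s]; last first.
    exact: measurable_start.
  apply: le_measure; rewrite ?inE; [exact: measurable_start| |exact: sub].
  by apply: bigsetU_measurable => s _; exact: measurable_start.
apply: le_trans (lee_sum _ (fun s _ => cP s)) _.
rewrite sumEFin lee_fin /next_mean mulr_sumr mulr_suml; apply: ler_sum => s _.
by rewrite /weight -cats1 big_cat big_seq1 cats1 mulrA.
Qed.

(** Induction on the window length. If [lambda <= K h], the probability of the history [h] is
    already within the bound; otherwise the crossing comes at least one sample later, and the
    supermartingale property averages the bounds of the children. *)
Lemma ville_from (n : nat) (h : seq T) : (k <= size h)%N ->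
  (P (history (size h) @^-1` [set h] `&` hit K lambda (size h) n)
    <= (weight h * K h / lambda)%:E)%E.
Proof.
elim: n h => [|n IHn] h kh; have [lK|Kl] := leP lambda (K h).
1,3: apply: (@le_trans _ _ (weight h)%:E); last first.
1,3: by rewrite lee_fin -mulrA ler_peMr // ler_pdivlMr // mul1r.
1,2: rewrite -prob_history; apply: le_measure; rewrite ?inE.
1,4: by apply: measurable_start; exact: measurable_hit.
1,3: exact: measurable_history.
1,2: exact: subIsetl.
- rewrite (_ : _ `&` _ = set0).
    by rewrite measure0 lee_fin mulr_ge0 ?invr_ge0 ?mulr_ge0 // ltW.
  apply/seteqP; split => // omega [/= hE [m]].
  rewrite addn0 -eqn_leq => /eqP <-; rewrite hE => /le_lt_trans /(_ Kl).
  by rewrite ltxx.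
(* Since [K h < lambda], the window may open one step later. *)
- rewrite (_ : _ `&` _ = history (size h) @^-1` [set h] `&`
      hit K lambda (size h).+1 n); last first.
    apply/seteqP; split => omega [/= hE [m /andP[hm mn] lK]]; split => //.
      exists m => //; rewrite addSnnS mn andbT ltn_neqAle hm andbT.
      apply/eqP => hm'; move: lK; rewrite -hm' hE => /le_lt_trans /(_ Kl).
      by rewrite ltxx.
    by exists m => //; rewrite (ltnW hm) -addSnnS.
  apply: (@le_trans _ _ (weight h * next_mean p K h / lambda)%:E).
    apply: start_split => [|s]; first exact: measurable_hit.
    rewrite size_rcons -(size_rcons h s); apply: IHn.
    by rewrite size_rcons leqW.
  rewrite lee_fin ler_pM2r ?invr_gt0 //; apply: ler_wpM2l => //.
  exact: K_super.
Qed.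

(** Before the window opens, [start_split] only averages, which turns [K] into its mean [j] levels
    below [h]. *)
Lemma ville_mean (j n : nat) (h : seq T) : (k <= size h + j)%N ->
  (P (history (size h) @^-1` [set h] `&` hit K lambda (size h + j) n)
    <= (weight h * mean p j K h / lambda)%:E)%E.
Proof.
elim: j h => [|j IHj] h kh; first by rewrite addn0 in kh *; exact: ville_from.
apply: (@start_split _ _ (mean p j K)) => [|s]; first exact: measurable_hit.
by rewrite -addSnnS -(size_rcons h s); apply: IHj; rewrite size_rcons addSnnS.
Qed.

(** The empty history has weight [1], and continuity of [P] along the growing windows removes the
    horizon. Late crossings are thus controlled by the mean at time [i], which can be made small. *)
Lemma ville (i : nat) : (k <= i)%N ->
  (P [set omega | exists2 m, (i <= m)%N & (lambda <= K (history m omega))%R]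
    <= (mean p i K [::] / lambda)%:E)%E.
Proof.
move=> ki.
rewrite (_ : [set _ | _] = \bigcup_n hit K lambda i n); last first.
  apply/seteqP; split => omega /= [m].
    move=> im lK; exists (m - i)%N => //=; exists m => //.
    by rewrite im subnKC /=.
  by move=> _ [m' /andP[im' _] lK]; exists m'.
have mU : measurable (\bigcup_n hit K lambda i n).
  by apply: bigcupT_measurable => n; exact: measurable_hit.
have nd : nondecreasing_seq (hit K lambda i).
  move=> n1 n2 n12; apply/subsetPset => omega [m /andP[im mn] lK].
  by exists m => //; rewrite im (leq_trans mn) // leq_add2l.
apply: (cvge_to_le (@nondecreasing_cvg_mu _ _ _ P _ _ mU nd)) => [n|].
  exact: measurable_hit.
apply: nearW => n /=.
have := @ville_mean i n [::] ki.
by rewrite setIidr // /weight big_nil mul1r add0n.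
Qed.

End Supermartingale.

(** A statement of Robbins-Siegmund type, applied to both iterates. The drift is asked only from
    depth [N] on, where the killed process is shown to satisfy it. *)
Lemma drift_cvg0 (Y : seq T -> R) (N : nat) (mu C : R) (a : nat -> R) :
  0 < mu -> 0 <= C -> (forall h, 0 <= Y h) -> (forall k, 0 < a k) ->
  series a @ \oo --> +oo -> cvgn (series (fun k => a k ^+ 2)) ->
  (forall h, (N <= size h)%N -> next_mean p Y h <=
    (1 - mu * a (size h) + C * a (size h) ^+ 2) * Y h + C * a (size h) ^+ 2) ->
  {ae P, forall omega, Y (history n omega) @[n --> \oo] --> 0}.
Proof.
move=> mu0 C0 Y0 a0 suma suma2 Ydrift.
set a2 := fun k => a k ^+ 2 in suma2 *.
have a2ge0 k : 0 <= a2 k by exact: sqr_ge0.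
pose tail k := limn (series a2) - series a2 k.
have tailS k : tail k.+1 = tail k - a2 k.
  by rewrite /tail /series /= big_nat_recr //= opprD addrA.
have tail0 k : 0 <= tail k.
  rewrite subr_ge0; apply: nondecreasing_cvgn_le => //.
  by apply: nondecreasing_series => n _ _; exact: a2ge0.
have tail_cvg : tail k @[k --> \oo] --> 0.
  by rewrite -(subrr (limn (series a2))); apply: cvgB => //; exact: cvg_cst.
(* Half of the drift rate; the other half absorbs [C * a k ^+ 2 * Y] once [C * a k <= nu]. *)
pose nu := mu / 2.
have nu0 : 0 < nu by rewrite divr_gt0.
have [N1 [NN1 Csmall]] : exists N1, (N <= N1)%N /\
    forall k, (N1 <= k)%N -> C * a k <= nu.
  (* Dividing by [C + 1] allows [C = 0]. *)
  pose t := nu / (C + 1).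
  have t0 : 0 < t by rewrite divr_gt0 // ltr_wpDl.
  have /cvgr0Pnorm_lt /(_ (t ^+ 2)) := cvg_series_cvg_0 suma2.
  rewrite exprn_gt0 // => /(_ isT) [N0 _ N0P].
  exists (maxn N N0); split => [|k]; first exact: leq_maxl.
  rewrite geq_max => /andP[_ /N0P /=]; rewrite ger0_norm // => lt_a.
  have {}lt_a : a k <= t.
    by rewrite -(ler_pXn2r (n := 2)) // ?nnegrE ltW.
  have tC : t * (C + 1) = nu by rewrite /t divfK // gt_eqF // ltr_wpDl.
  have := a0 k; nra.
(* Adding the tail of the noise variances makes [Y] a supermartingale. *)
pose K h := Y h + C * tail (size h).
have K0 h : 0 <= K h by rewrite addr_ge0 // mulr_ge0.
have Kdrift h : (N1 <= size h)%N ->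
    next_mean p K h <= K h + - (nu * a (size h)) * Y h.
  move=> hN1.
  have -> : next_mean p K h = next_mean p Y h + C * tail (size h).+1.
    rewrite /next_mean /K; under eq_bigr do rewrite mulrDr size_rcons.
    by rewrite big_split /= -mulr_suml p_pmf.2 mul1r.
  have := Ydrift h (leq_trans NN1 hN1); have := Csmall _ hN1.
  rewrite /K tailS /a2 /nu; have := a0 (size h); have := Y0 h.
  set y := Y h; set ak := a (size h); set m := next_mean p Y h.
  move=> y0 ak0 Ca; have : 0 <= ak * y * (mu / 2 - C * ak).
    by rewrite mulr_ge0 ?mulr_ge0 ?subr_ge0 // ltW.
  nra.
have Ksuper h : (N1 <= size h)%N -> next_mean p K h <= K h.
  move=> /Kdrift /le_trans; apply; rewrite gerDl mulNr oppr_le0.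
  by rewrite !mulr_ge0 // ltW.
(* If every mean of [K] stayed at least [eps], the tail would eventually account for at most
   [eps / 2], so each step would lower the mean by at least [nu * (eps / 2)] times the step size; as
   these sizes have a divergent sum, it would become negative. *)
have small_mean eps : 0 < eps ->
    exists2 n, (N1 <= n)%N & mean p n K [::] < eps.
  move=> eps0; apply: contrapT => nosmall.
  have C1 : 0 < C + 1 by rewrite ltr_wpDl.
  have /cvgr0Pnorm_lt /(_ (eps / 2 / (C + 1))) := tail_cvg.
  rewrite !divr_gt0 // => /(_ isT) [n1 _ n1P].
  pose n2 := maxn n1 N1.
  have Ybig j : eps / 2 <= mean p (n2 + j) Y [::].
    have /andP[? ?] : (n1 <= n2 + j)%N && (N1 <= n2 + j)%N.
      by rewrite -geq_max leq_addr.
    have : eps <= mean p (n2 + j) K [::].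
      by rewrite leNgt; apply/negP => lt_eps; apply: nosmall; exists (n2 + j)%N.
    rewrite (_ : mean _ _ K _ = mean p (n2 + j) Y [::] + C * tail (n2 + j)%N).
      have := n1P (n2 + j)%N; rewrite /= ger0_norm // => /(_ _) tP.
      have {}tP : tail (n2 + j)%N < eps / 2 / (C + 1) by exact: tP.
      have : C * tail (n2 + j)%N <= eps / 2.
        apply: (@le_trans _ _ ((C + 1) * tail (n2 + j)%N)).
          by rewrite ler_wpM2r // lerDl.
        by rewrite mulrC -ler_pdivlMr // ltW.
      lra.
    rewrite (eq_mean p_pmf
      (G := fun h => 1 * Y h + C * (fun=> tail (n2 + j)%N) h)).
      by rewrite mean_affine (mean_cst p_pmf) mul1r.
    by move=> h /= hE; rewrite mul1r /K hE.
  have step j : mean p (n2 + j) K [::] <=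
      mean p n2 K [::] - nu * (eps / 2) * (series a (n2 + j)%N - series a n2).
    elim: j => [|j IHj]; first by rewrite addn0 subrr mulr0 subr0.
    rewrite addnS -mean_next.
    have le1 : mean p (n2 + j) (next_mean p K) [::] <=
        mean p (n2 + j) K [::] - nu * a (n2 + j)%N * mean p (n2 + j) Y [::].
      rewrite -[mean _ _ K _]mul1r -mulNr -mean_affine.
      apply: (le_mean p_pmf) => h /=; rewrite add0n => hE.
      rewrite mul1r -hE; apply: Kdrift.
      by rewrite hE /n2 (leq_trans _ (leq_addr _ _)) // leq_maxr.
    have := Ybig j; have := a0 (n2 + j)%N; move: le1 IHj.
    have -> : series a (n2 + j).+1 = series a (n2 + j)%N + a (n2 + j)%N.
      by rewrite /series /= big_nat_recr.
    move: (mean p (n2 + j) Y [::]) (a (n2 + j)%N) => y aj le1 IHj aj0 ybig.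
    have : 0 <= nu * aj * (y - eps / 2) by rewrite !mulr_ge0 ?subr_ge0 // ltW.
    nra.
  (* Past this threshold the bound of [step] is at most [-1], against [K0]. *)
  have : \forall n \near \oo,
      (mean p n2 K [::] + 1) / (nu * (eps / 2)) + series a n2 <= series a n.
    by move/cvgryPge: suma; apply.
  move=> [n3 _ /(_ (n2 + n3)%N)]; rewrite /= leq_addl => /(_ isT) big.
  have := step n3; have := mean_ge0 p_pmf (n2 + n3) [::] K0.
  have ne0 : 0 < nu * (eps / 2) by rewrite mulr_gt0 // divr_gt0.
  have := big; rewrite -lerBrDr ler_pdivrMr // => {}big.
  lra.
(* If [Y] does not tend to [0] along a path, some [eps] makes the path bad; and a bad path has
   crossings after every time, whose probability [ville] bounds. *)
pose bad (eps : R) : set Omega := [set omega |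
  forall n, exists2 m, (n <= m)%N & eps <= K (history m omega)].
have bad_negl eps : 0 < eps -> P.-negligible (bad eps).
  move=> eps0.
  pose late n : set Omega :=
    [set omega | exists2 m, (n <= m)%N & eps <= K (history m omega)].
  have badE : bad eps = \bigcap_n late n.
    by apply/seteqP; split => omega /= B n; [move=> _; exact: B|exact: B].
  have mlate n : measurable (late n).
    rewrite (_ : late n = \bigcup_(m in [set m | (n <= m)%N])
        history m @^-1` [set h | eps <= K h]).
      by apply: bigcup_measurable => m _; exact: measurable_history.
    by apply/seteqP; split => omega [m nm eK]; exists m.
  have mbad : measurable (bad eps) by rewrite badE; apply: bigcapT_measurable.
  apply/negligibleP => //; apply/eqP; rewrite -measure_le0.
  apply/lee_addgt0Pr => e e0; rewrite add0e.
  (* [ville] divides the mean by [eps], so a mean below [e * eps] gives probability at most [e]. *)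
  have [|n N1n Kn] := small_mean (e * eps); first exact: mulr_gt0.
  apply: (@le_trans _ _ (P (late n))).
    apply: le_measure; rewrite ?inE // badE.
    by move=> omega /(_ n); exact.
  apply: le_trans (ville eps0 K0 Ksuper N1n) _.
  by rewrite lee_fin ler_pdivrMr // ltW.
apply: (negligibleS (A := \bigcup_n bad n.+1%:R^-1)); last first.
  by apply: negligible_bigcup => n; apply: bad_negl; rewrite invr_gt0.
move=> omega; apply: contra_notP => notbad.
apply/cvgr0Pnorm_lt => eps eps0.
have [n n_eps] : exists n : nat, n.+1%:R^-1 < eps.
  have /cvgr0Pnorm_lt /(_ _ eps0) [n _ /(_ n (leqnn n)) nP] := @cvg_harmonic R.
  by exists n; rewrite /= ger0_norm // in nP.
have : ~ bad n.+1%:R^-1 omega by move=> b; apply: notbad; exists n.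
move=> /existsNP[n0 n0P]; exists n0 => // m /= n0m.
rewrite ger0_norm //; apply: lt_trans n_eps; rewrite ltNge; apply/negP => le_Y.
apply: n0P; exists m => //; apply: le_trans le_Y _.
by rewrite /K lerDl mulr_ge0.
Qed.

End Ville.

(** * The Frobenius inner product *)

Section Frobenius.
Context (R : realType).

(** On column vectors this is the Euclidean product, so one set of lemmas serves both the weights
    and the matrices. *)
Definition frob (n k : nat) (A B : 'M[R]_(n, k)) : R := \tr (A *m B^T).

Definition nsq (n k : nat) (A : 'M[R]_(n, k)) : R := frob A A.

Lemma frobE (n k : nat) (A B : 'M[R]_(n, k)) :
  frob A B = \sum_i \sum_j A i j * B i j.
Proof.
by apply: eq_bigr => i _; rewrite mxE; apply: eq_bigr => j _; rewrite mxE.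
Qed.

Lemma frobC (n k : nat) (A B : 'M[R]_(n, k)) : frob A B = frob B A.
Proof. by rewrite /frob -mxtrace_tr trmx_mul trmxK. Qed.

Lemma frobDl (n k : nat) (A B C : 'M[R]_(n, k)) :
  frob (A + B) C = frob A C + frob B C.
Proof. by rewrite /frob mulmxDl mxtraceD. Qed.

Lemma frobDr (n k : nat) (A B C : 'M[R]_(n, k)) :
  frob C (A + B) = frob C A + frob C B.
Proof. by rewrite frobC frobDl !(frobC C). Qed.

Lemma frobZl (n k : nat) a (A B : 'M[R]_(n, k)) :
  frob (a *: A) B = a * frob A B.
Proof. by rewrite /frob -scalemxAl mxtraceZ. Qed.

Lemma frobZr (n k : nat) a (A B : 'M[R]_(n, k)) :
  frob A (a *: B) = a * frob A B.
Proof. by rewrite frobC frobZl frobC. Qed.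

Lemma frobNr (n k : nat) (A B : 'M[R]_(n, k)) : frob A (- B) = - frob A B.
Proof. by rewrite -scaleN1r frobZr mulN1r. Qed.

Lemma frob_sumr (n k : nat) (I : finType) (A : 'M[R]_(n, k))
    (F : I -> 'M[R]_(n, k)) : frob A (\sum_i F i) = \sum_i frob A (F i).
Proof. by rewrite /frob raddf_sum mulmx_sumr raddf_sum. Qed.

Lemma frob_trmx (n k : nat) (A B : 'M[R]_(n, k)) : frob A^T B^T = frob A B.
Proof. by rewrite /frob trmxK mxtrace_mulC -/(frob B A) frobC. Qed.

Lemma frob_mulmx_adj (n k l : nat) (A : 'M[R]_(n, k)) (B : 'M[R]_(n, l))
    (C : 'M[R]_(l, k)) : frob A (B *m C) = frob (A *m C^T) B.
Proof. by rewrite /frob trmx_mul mulmxA. Qed.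

Lemma frob_adj_mulmx (n k l : nat) (A : 'M[R]_(n, k)) (B : 'M[R]_(l, k))
    (C : 'M[R]_(l, n)) : frob A (C^T *m B) = frob (C *m A) B.
Proof.
by rewrite /frob trmx_mul trmxK mulmxA mxtrace_mulC mulmxA.
Qed.

Lemma nsq_ge0 (n k : nat) (A : 'M[R]_(n, k)) : 0 <= nsq A.
Proof.
by rewrite /nsq frobE; do 2!apply: sumr_ge0 => ? _; rewrite -expr2 sqr_ge0.
Qed.

Lemma sqr_coord_le_nsq (n k : nat) (A : 'M[R]_(n, k)) i j :
  A i j ^+ 2 <= nsq A.
Proof.
rewrite /nsq frobE (bigD1 i) //= (bigD1 j) //= -expr2 -addrA lerDl.
by rewrite addr_ge0 //; do ?[apply: sumr_ge0 => ? _]; rewrite -expr2 sqr_ge0.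
Qed.

Lemma nsq_eq0 (n k : nat) (A : 'M[R]_(n, k)) : nsq A <= 0 -> A = 0.
Proof.
move=> A0; apply/matrixP => i j; rewrite mxE; apply/eqP.
by rewrite -sqrf_eq0 eq_le sqr_ge0 (le_trans (sqr_coord_le_nsq A i j)).
Qed.

Lemma nsqD (n k : nat) (A B : 'M[R]_(n, k)) :
  nsq (A + B) = nsq A + 2 * frob A B + nsq B.
Proof. by rewrite /nsq frobDl !frobDr (frobC B A); ring. Qed.

Lemma nsqZ (n k : nat) a (A : 'M[R]_(n, k)) : nsq (a *: A) = a ^+ 2 * nsq A.
Proof. by rewrite /nsq frobZl frobZr; ring. Qed.

Lemma nsqN (n k : nat) (A : 'M[R]_(n, k)) : nsq (- A) = nsq A.
Proof. by rewrite -scaleN1r nsqZ sqrrN expr1n mul1r. Qed.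

Lemma nsqT (n k : nat) (A : 'M[R]_(n, k)) : nsq A^T = nsq A.
Proof. exact: frob_trmx. Qed.

Lemma nsqD_le (n k : nat) (A B : 'M[R]_(n, k)) :
  nsq (A + B) <= 2 * nsq A + 2 * nsq B.
Proof.
by have := nsq_ge0 (A - B); rewrite !nsqD frobNr nsqN; lra.
Qed.

(** Young's inequality: expand [nsq (t *: A - B)], which is nonnegative, and divide by [t]. *)
Lemma frob_young (n k : nat) t (A B : 'M[R]_(n, k)) :
  0 < t -> 2 * frob A B <= t * nsq A + nsq B / t.
Proof.
move=> t0; have := nsq_ge0 (t *: A - B).
rewrite nsqD nsqZ frobNr frobZl nsqN => ge0.
have -> : t * nsq A + nsq B / t = (t ^+ 2 * nsq A + nsq B) / t.
  by field; rewrite gt_eqF.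
rewrite ler_pdivlMr //; nra.
Qed.

(** Lagrange's identity: the defect is half the double sum of the squares of
    [a i * b j - a j * b i]. *)
Lemma sum_cauchy_schwarz (I : finType) (a b : I -> R) :
  (\sum_i a i * b i) ^+ 2 <= (\sum_i a i * a i) * (\sum_i b i * b i).
Proof.
have : 0 <= \sum_i \sum_j (a i * b j - a j * b i) ^+ 2.
  by do 2!apply: sumr_ge0 => ? _; rewrite sqr_ge0.
have -> : \sum_i \sum_j (a i * b j - a j * b i) ^+ 2 =
    2 * ((\sum_i a i * a i) * (\sum_i b i * b i)) -
    2 * (\sum_i a i * b i) ^+ 2.
  have ab : (\sum_i a i * a i) * (\sum_i b i * b i) =
      \sum_i \sum_j (a i * a i) * (b j * b j).
    by rewrite mulr_suml; apply: eq_bigr => i _; rewrite mulr_sumr.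
  have ba : (\sum_i a i * a i) * (\sum_i b i * b i) =
      \sum_i \sum_j (a j * a j) * (b i * b i) by rewrite ab exchange_big.
  have -> : (\sum_i a i * b i) ^+ 2 = \sum_i \sum_j (a i * b i) * (a j * b j).
    by rewrite expr2 mulr_suml; apply: eq_bigr => i _; rewrite mulr_sumr.
  rewrite mulr_natl mulr2n {1}ab ba mulr_sumr -big_split -sumrB /=.
  apply: eq_bigr => i _; rewrite mulr_sumr -big_split -sumrB /=.
  by apply: eq_bigr => j _; ring.
by rewrite subr_ge0 ler_pM2l.
Qed.

(** Cauchy-Schwarz on each entry, a row of [A] against a column of [B]. *)
Lemma nsqM (n k l : nat) (A : 'M[R]_(n, k)) (B : 'M[R]_(k, l)) :
  nsq (A *m B) <= nsq A * nsq B.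
Proof.
rewrite -(nsqT B) /nsq !frobE mulr_suml; apply: ler_sum => i _.
rewrite mulr_sumr; apply: ler_sum => j _; rewrite -expr2 mxE.
apply: le_trans (sum_cauchy_schwarz _ _) _.
rewrite le_eqVlt; apply/orP; left; apply/eqP; congr (_ * _).
by apply: eq_bigr => k' _; rewrite !mxE.
Qed.

End Frobenius.

(** * Finite averages and coercivity of the second moment *)

Section FiniteMean.
Context (R : realType) (T : finType) (p : T -> R).
Hypothesis p_pmf : is_pmf p.

Definition average (n k : nat) (F : T -> 'M[R]_(n, k)) : 'M[R]_(n, k) :=
  \sum_s p s *: F s.

Lemma frob_average (n k : nat) (X : 'M[R]_(n, k)) (F : T -> 'M[R]_(n, k)) :
  frob X (average F) = \sum_s p s * frob X (F s).
Proof. by rewrite frob_sumr; apply: eq_bigr => s _; rewrite frobZr. Qed.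

Lemma mulmx_average (n k l : nat) (X : 'M[R]_(n, k)) (F : T -> 'M[R]_(k, l)) :
  X *m average F = average (fun s => X *m F s).
Proof. by rewrite mulmx_sumr; apply: eq_bigr => s _; rewrite scalemxAr. Qed.

Lemma average_mulmx (n k l : nat) (X : 'M[R]_(k, l)) (F : T -> 'M[R]_(n, k)) :
  average F *m X = average (fun s => F s *m X).
Proof. by rewrite mulmx_suml; apply: eq_bigr => s _; rewrite scalemxAl. Qed.

Lemma averageB (n k : nat) (F G : T -> 'M[R]_(n, k)) :
  average (fun s => F s - G s) = average F - average G.
Proof. by rewrite -sumrB; apply: eq_bigr => s _; rewrite scalerBr. Qed.

Lemma averageN (n k : nat) (F : T -> 'M[R]_(n, k)) :
  average (fun s => - F s) = - average F.
Proof. by rewrite -sumrN; apply: eq_bigr => s _; rewrite scalerN. Qed.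

Lemma averageT (n k : nat) (F : T -> 'M[R]_(n, k)) :
  average (fun s => (F s)^T) = (average F)^T.
Proof. by rewrite raddf_sum; apply: eq_bigr => s _; rewrite /= linearZ. Qed.

(** Both drift estimates start here: at first order in [a] only the mean field is seen, and the
    fluctuations enter at order [a ^+ 2]. *)
Lemma mean_nsq_step (n k : nat) (X : 'M[R]_(n, k)) (F : T -> 'M[R]_(n, k)) a :
  \sum_s p s * nsq (X + a *: F s) =
  nsq X + 2 * a * frob X (average F) + a ^+ 2 * \sum_s p s * nsq (F s).
Proof.
have -> : nsq X = \sum_s p s * nsq X by rewrite -mulr_suml p_pmf.2 mul1r.
rewrite frob_average !mulr_sumr -!big_split /=.
by apply: eq_bigr => s _; rewrite nsqD nsqZ frobZr; ring.
Qed.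

Lemma nsq_average_le (n k : nat) (F : T -> 'M[R]_(n, k)) :
  nsq (average F) <= \sum_s p s * nsq (F s).
Proof.
(* The variance of [F], read as a unit step from [- average F]. *)
have : 0 <= \sum_s p s * nsq (- average F + 1 *: F s).
  by apply: sumr_ge0 => s _; rewrite mulr_ge0 ?nsq_ge0 //; exact: p_pmf.1.
rewrite mean_nsq_step nsqN frobC frobNr -/(nsq _); lra.
Qed.

Section SecondMoment.
Context (m : nat) (f : T -> 'cV[R]_m).
Let G := average (fun s => f s *m (f s)^T).
Hypothesis G_unit : G \in unitmx.

Lemma second_moment_sym : G^T = G.
Proof.
rewrite -averageT; apply: eq_bigr => s _.
by rewrite trmx_mul trmxK.
Qed.

Lemma frob_second_moment (n : nat) (U : 'M[R]_(n, m)) :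
  frob U (U *m G) = \sum_s p s * nsq (U *m f s).
Proof.
rewrite mulmx_average frob_average; apply: eq_bigr => s _; congr (_ * _).
by rewrite mulmxA frob_mulmx_adj trmxK.
Qed.

(** [U *m G] averages the products of [U *m f s] with [(f s)^T]; Jensen's inequality and
    submultiplicativity conclude, the sum of all [nsq (f s)] dominating each one. *)
Lemma nsq_mul_second_moment (n : nat) (U : 'M[R]_(n, m)) :
  nsq (U *m G) <= (\sum_s nsq (f s)) * frob U (U *m G).
Proof.
rewrite frob_second_moment mulmx_average; apply: le_trans (nsq_average_le _) _.
rewrite mulr_sumr; apply: ler_sum => s _; rewrite mulrCA.
apply: ler_wpM2l; first exact: p_pmf.1.
rewrite mulmxA; apply: le_trans (nsqM _ _) _; rewrite nsqT mulrC.
apply: ler_wpM2r; first exact: nsq_ge0.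
by rewrite (bigD1 s) //= lerDl sumr_ge0 // => ? _; exact: nsq_ge0.
Qed.

(** [U] is [U *m G] times [invmx G], so [nsq U] is at most [nsq (U *m G) * nsq (invmx G)], and the
    previous lemma bounds the first factor by the quadratic form. *)
Lemma second_moment_coercive : exists2 lambda, 0 < lambda &
  forall (n : nat) (U : 'M[R]_(n, m)), lambda * nsq U <= frob U (U *m G).
Proof.
pose B := (\sum_s nsq (f s)) * nsq (invmx G).
have B0 : 0 <= B.
  by rewrite mulr_ge0 ?nsq_ge0 // sumr_ge0 // => ? _; exact: nsq_ge0.
have B1 : 0 < 1 + B by rewrite ltr_pwDl.
exists (1 + B)^-1 => [|n U]; first by rewrite invr_gt0.
rewrite mulrC ler_pdivrMr // mulrDr mulr1.
have q0 : 0 <= frob U (U *m G).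
  rewrite frob_second_moment; apply: sumr_ge0 => s _.
  by rewrite mulr_ge0 ?nsq_ge0 //; exact: p_pmf.1.
apply: (@le_trans _ _ (frob U (U *m G) * B)); last by rewrite lerDr.
rewrite -{1}(mulmxK G_unit U); apply: le_trans (nsqM _ _) _.
rewrite /B mulrA ler_wpM2r ?nsq_ge0 // mulrC; exact: nsq_mul_second_moment.
Qed.

(** For [y = invmx G *m (A *m e)] the form is that of [G] at [y], and [e] is recovered as
    [invmx A *m G *m y]; a lower bound in [nsq y] is therefore one in [nsq e]. *)
Lemma inv_second_moment_coercive (A : 'M[R]_m) : A \in unitmx ->
  exists2 kappa, 0 < kappa &
  forall e : 'cV[R]_m, kappa * nsq e <= frob e (A^T *m invmx G *m A *m e).
Proof.
move=> A_unit; have [lambda lambda0 coer] := second_moment_coercive.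
pose B := nsq (invmx A *m G).
have B1 : 0 < 1 + B by rewrite ltr_pwDl // nsq_ge0.
exists (lambda / (1 + B)) => [|e]; first by rewrite divr_gt0.
pose y := invmx G *m (A *m e).
have Gy : G *m y = A *m e by rewrite /y mulKVmx.
rewrite -!mulmxA frob_adj_mulmx -/y -Gy.
have -> : frob (G *m y) y = frob y^T (y^T *m G).
  by rewrite -[G in RHS]second_moment_sym -trmx_mul frob_trmx frobC.
apply: le_trans (coer _ _); rewrite nsqT mulrAC ler_pdivrMr //.
rewrite -mulrA ler_pM2l //.
have -> : e = invmx A *m G *m y by rewrite -mulmxA Gy mulKmx.
apply: le_trans (nsqM _ _) _; rewrite mulrC ler_wpM2l ?nsq_ge0 //.
by rewrite lerDr.
Qed.

End SecondMoment.

End FiniteMean.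

(** * Drift and convergence of the two iterates *)

Section DynaStep.
Context (R : realType) (m : nat) (T : finType) (p : T -> R).
Context (f g : T -> 'cV[R]_m) (r : T -> R) (alpha beta : nat -> R).

Let Gs s : 'M[R]_m := f s *m (f s)^T.
Let As s : 'M[R]_m := f s *m (f s - g s)^T.
Let bs s : 'cV[R]_m := r s *: f s.
Let G : 'M[R]_m := average p Gs.
Let A : 'M[R]_m := average p As.
Let c : 'cV[R]_m := average p bs.

(* The iteration with [g] standing for [gamma *: xhat]; there
   [delta *: f s = bs s - As s *m w]. *)
Definition dyna_step (k : nat) (st : 'cV[R]_m * 'M[R]_m) (s : T) :=
  (st.1 - alpha k *: (st.2 *m (bs s - As s *m st.1)),
   st.2 + beta k *: (- (As s)^T - st.2 *m Gs s)).

Hypothesis alpha_gt0 : forall k, 0 < alpha k.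
Hypothesis beta_gt0 : forall k, 0 < beta k.
Hypothesis p_pmf : is_pmf p.
Hypothesis G_unit : G \in unitmx.
Hypothesis A_unit : A \in unitmx.

(** The zeros of the two mean fields: [- A^T - Vstar *m G] and [c - A *m wstar] vanish. *)
Let Vstar : 'M[R]_m := - A^T *m invmx G.
Let wstar : 'cV[R]_m := invmx A *m c.

(** The mean increment is [- (U *m G)] for the error [U], so coercivity of [G] contracts at rate
    [2 * lambda]; the second moment of the increment is at most affine in [nsq U]. *)
Lemma dyna_step_V_drift : exists mu C, [/\ 0 < mu, 0 <= C &
  forall k st, \sum_s p s * nsq ((dyna_step k st s).2 - Vstar) <=
    (1 - mu * beta k + C * beta k ^+ 2) * nsq (st.2 - Vstar)
    + C * beta k ^+ 2].
Proof.
have [lambda lambda0 coer] := second_moment_coercive p_pmf G_unit.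
(* The increment at [Vstar]; what remains of the increment is linear in the error. *)
pose noise s := - (As s)^T - Vstar *m Gs s.
pose C := \sum_s p s * (2 * nsq (noise s) + 2 * nsq (Gs s)).
have C0 : 0 <= C.
  apply: sumr_ge0 => s _; apply: mulr_ge0; first exact: p_pmf.1.
  by rewrite addr_ge0 // mulr_ge0 // nsq_ge0.
exists (2 * lambda), C; split => [||k [w V] /=]; [exact: mulr_gt0|by []|].
pose F s := - (As s)^T - V *m Gs s.
set U := V - Vstar.
have FE s : F s = noise s - U *m Gs s.
  by rewrite /F /noise /U mulmxBl opprB addrA addrNK.
have EF : average p F = - (U *m G).
  rewrite averageB averageN averageT -mulmx_average -/A -/G mulmxBl.
  by rewrite /Vstar mulmxKV // opprB addrC.
under eq_bigr do rewrite addrAC -/U -/(F _).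
rewrite (mean_nsq_step p_pmf) EF frobNr.
have Fle : \sum_s p s * nsq (F s) <= C * nsq U + C.
  apply: (@le_trans _ _
    (\sum_s p s * ((2 * nsq (noise s) + 2 * nsq (Gs s)) * (nsq U + 1)))).
    apply: ler_sum => s _; apply: ler_wpM2l; first exact: p_pmf.1.
    rewrite FE; apply: le_trans (nsqD_le _ _) _; rewrite nsqN.
    have := nsqM U (Gs s); have := nsq_ge0 (noise s); have := nsq_ge0 (Gs s).
    have := nsq_ge0 U; nra.
  under eq_bigr do rewrite mulrA; rewrite -mulr_suml -/C mulrDr mulr1 //.
have b0 := ltW (beta_gt0 k); have := coer _ U.
set q := frob U (U *m G); set S := \sum_s _ in Fle *.
move=> coerU; have : 0 <= beta k * (q - lambda * nsq U).
  by rewrite mulr_ge0 // subr_ge0.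
have : 0 <= beta k ^+ 2 * (C * nsq U + C - S).
  by rewrite mulr_ge0 ?sqr_ge0 // subr_ge0.
nra.
Qed.

(** Closeness of the matrix to [Vstar] serves twice: the mean field keeps part of the contraction it
    has at [Vstar], and the matrix is bounded, which controls the second moment of the step. *)
Lemma dyna_step_w_drift : exists mu C eps, [/\ 0 < mu, 0 <= C, 0 < eps &
  forall k st, nsq (st.2 - Vstar) <= eps ->
    \sum_s p s * nsq ((dyna_step k st s).1 - wstar) <=
    (1 - mu * alpha k + C * alpha k ^+ 2) * nsq (st.1 - wstar)
    + C * alpha k ^+ 2].
Proof.
have [kappa kappa0 coer] := inv_second_moment_coercive p_pmf G_unit A_unit.
pose noise s := As s *m wstar - bs s.
(* Chosen to give [epsA], the margin that Young's inequality needs in [drift]. *)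
pose eps := kappa ^+ 2 / (2 * (1 + nsq A)).
have A1 : 0 < 1 + nsq A by rewrite ltr_pwDl // nsq_ge0.
have eps0 : 0 < eps by rewrite divr_gt0 ?exprn_gt0 ?mulr_gt0.
have epsA : 2 * eps * nsq A <= kappa ^+ 2.
  have -> : kappa ^+ 2 = 2 * eps * (1 + nsq A).
    by rewrite /eps; field; rewrite gt_eqF.
  by rewrite ler_wpM2l ?lerDr // mulr_ge0 // ltW.
pose D := \sum_s p s * (2 * nsq (As s) + 2 * nsq (noise s)).
have D0 : 0 <= D.
  apply: sumr_ge0 => s _; apply: mulr_ge0; first exact: p_pmf.1.
  by rewrite addr_ge0 // mulr_ge0 // nsq_ge0.
pose v := 2 * nsq Vstar + 2 * eps.
have v0 : 0 <= v.
  by apply: addr_ge0; apply: mulr_ge0 => //; [exact: nsq_ge0|exact: ltW].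
exists (kappa / 2), (v * D), eps.
split; [by rewrite divr_gt0|exact: mulr_ge0|by []|].
move=> k [w V] /=; set U := V - Vstar; set e := w - wstar => Ueps.
have VE : V = Vstar + U by rewrite /U addrC addrNK.
pose F s := V *m (As s *m e + noise s).
have EF : average p F = V *m (A *m e).
  rewrite -mulmx_average; congr (_ *m _).
  rewrite /average; under eq_bigr do rewrite scalerDr.
  rewrite big_split /= -/(average p (fun s => As s *m e)) -average_mulmx.
  rewrite -/(average p noise) averageB -average_mulmx -/A -/c.
  by rewrite /wstar mulKVmx // subrr addr0.
have stepE s : w - alpha k *: (V *m (bs s - As s *m w)) - wstar =
    e + alpha k *: F s.
  rewrite addrAC -/e; congr (_ + _); rewrite -scalerN -mulmxN; congr (_ *: _).
  by rewrite /F /noise /e; congr (_ *m _); rewrite mulmxBr opprB addrA addrNK.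
under eq_bigr do rewrite stepE.
rewrite (mean_nsq_step p_pmf) EF.
have nV : nsq V <= v.
  by rewrite VE; apply: le_trans (nsqD_le _ _) _; rewrite lerD2l ler_pM2l.
have Fle : \sum_s p s * nsq (F s) <= v * D * nsq e + v * D.
  apply: (@le_trans _ _ (\sum_s p s *
      ((2 * nsq (As s) + 2 * nsq (noise s)) * (v * (nsq e + 1))))).
    apply: ler_sum => s _; apply: ler_wpM2l; first exact: p_pmf.1.
    apply: le_trans (nsqM _ _) _.
    have inner : nsq (As s *m e + noise s) <=
        (2 * nsq (As s) + 2 * nsq (noise s)) * (nsq e + 1).
      apply: le_trans (nsqD_le _ _) _.
      have := nsqM (As s) e; have := nsq_ge0 (noise s).
      by have := nsq_ge0 (As s); have := nsq_ge0 e; nra.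
    rewrite [leRHS]mulrCA; apply: ler_pM; rewrite ?nsq_ge0 //.
  under eq_bigr do rewrite mulrA; rewrite -mulr_suml -/D.
  by rewrite mulrCA mulrA mulrDr mulr1.
(* In units of [nsq e]: the [Vstar] part contributes at most [- 2 * kappa], and Young's inequality
   with parameter [kappa] adds [kappa] and, by the choice of [eps], [kappa / 2]. *)
have drift : 2 * frob e (V *m (A *m e)) <= - (kappa / 2) * nsq e.
  rewrite VE mulmxDl frobDr.
  have -> : frob e (Vstar *m (A *m e)) = - frob e (A^T *m invmx G *m A *m e).
    by rewrite /Vstar !mulNmx frobNr !mulmxA.
  have young := frob_young e (U *m (A *m e)) kappa0.
  have UAe : nsq (U *m (A *m e)) / kappa <= kappa / 2 * nsq e.
    rewrite ler_pdivrMr //; apply: le_trans (nsqM _ _) _.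
    apply: (@le_trans _ _ (eps * (nsq A * nsq e))).
      by apply: ler_pM; rewrite ?nsq_ge0 ?nsqM.
    rewrite mulrA -[leRHS]mulrA [nsq e * _]mulrC mulrA ler_wpM2r ?nsq_ge0 //.
    by move: epsA; nra.
  by have := coer e; move: young UAe; lra.
have a0 := ltW (alpha_gt0 k).
set q := frob e _ in drift *; set S := \sum_s _ in Fle *.
have : 0 <= alpha k * (- (kappa / 2) * nsq e - 2 * q).
  by rewrite mulr_ge0 // subr_ge0.
have : 0 <= alpha k ^+ 2 * (v * D * nsq e + v * D - S).
  by rewrite mulr_ge0 ?sqr_ge0 // subr_ge0.
nra.
Qed.

Section AlmostSure.
Context (d : measure_display) (Omega : measurableType d)
  (P : probability Omega R) (Z : nat -> Omega -> T).
Hypothesis Z_iid : iid_with_pmf P p Z.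
Hypothesis alpha_sum : series alpha @ \oo --> +oo.
Hypothesis beta_sum : series beta @ \oo --> +oo.
Hypothesis alpha_sqr : cvgn (series (fun k => alpha k ^+ 2)).
Hypothesis beta_sqr : cvgn (series (fun k => beta k ^+ 2)).
Context (st : seq T -> 'cV[R]_m * 'M[R]_m).
Hypothesis st_rcons : forall h s,
  st (rcons h s) = dyna_step (size h) (st h) s.

Lemma dyna_V_ae : {ae P, forall omega,
  nsq ((st (history Z n omega)).2 - Vstar) @[n --> \oo] --> 0}.
Proof.
have [mu [C [mu0 C0 drift]]] := dyna_step_V_drift.
pose Y h := nsq ((st h).2 - Vstar).
apply: (@drift_cvg0 _ _ _ P _ p Z p_pmf Z_iid Y 0 mu C beta) => //.
  by move=> h; exact: nsq_ge0.
move=> h _; rewrite /next_mean; under eq_bigr do rewrite /Y st_rcons.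
exact: drift.
Qed.

Lemma dyna_w_ae : {ae P, forall omega,
  nsq ((st (history Z n omega)).1 - wstar) @[n --> \oo] --> 0}.
Proof.
have [mu [C [eps [mu0 C0 eps0 drift]]]] := dyna_step_w_drift.
pose close h := nsq ((st h).2 - Vstar) <= eps.
(* Not yet killed: the range of length [(size h).+1] includes the present time. *)
pose good N h :=
  all (fun j => (j < N)%N || close (take j h)) (iota 0 (size h).+1).
pose Y N h : R := if good N h then nsq ((st h).1 - wstar) else 0.
have goodP N h : (N <= size h)%N -> good N h -> close h.
  move=> Nh /allP /(_ (size h)).
  rewrite mem_iota ltnS leqnn ltnNge Nh take_size.
  exact.
have good_rcons N h s : good N (rcons h s) -> good N h.
  move=> /allP gd; apply/allP => j; rewrite mem_iota add0n ltnS => /= jh.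
  have := gd j; rewrite mem_iota size_rcons add0n ltnS leqW // => /(_ isT).
  by rewrite -cats1 takel_cat.
have YN N : {ae P, forall omega, Y N (history Z n omega) @[n --> \oo] --> 0}.
  apply: (@drift_cvg0 _ _ _ P _ p Z p_pmf Z_iid (Y N) N mu C alpha) => //.
    by move=> h; rewrite /Y; case: ifP => // _; exact: nsq_ge0.
  move=> h Nh; rewrite /next_mean {2}/Y; case: ifP => [gd|/negP ngd].
    (* Killing a child replaces its value by [0], so the unkilled drift still bounds the mean. *)
    apply: le_trans (drift _ _ (goodP _ _ Nh gd)); apply: ler_sum => s _.
    apply: ler_wpM2l; first exact: p_pmf.1.
    by rewrite /Y st_rcons; case: ifP => // _; exact: nsq_ge0.
  (* Once killed, always killed: every child has value [0]. *)
  rewrite big1 => [|s _]; first by rewrite mulr0 add0r (mulr_ge0 C0) ?sqr_ge0.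
  by rewrite /Y ifN ?mulr0 //; apply/negP => /good_rcons.
have := dyna_V_ae; have := ae_foralln YN.
(* Here [N] depends on the path: from then on the matrix stays close, so the path is never killed
   for this [N]. *)
apply: filterS2 => omega Ycvg /cvgr0Pnorm_le /(_ _ eps0) [N _ NP].
have gd n : good N (history Z n omega).
  apply/allP => j; rewrite mem_iota size_history add0n ltnS => /= jn.
  rewrite take_history //; case: ltnP => //= Nj.
  by have := NP j Nj; rewrite /= ger0_norm ?nsq_ge0.
have := Ycvg N; rewrite (_ : (fun n => _) =
  (fun n => nsq ((st (history Z n omega)).1 - wstar))) //.
by apply/funext => n; rewrite /Y gd.
Qed.

End AlmostSure.

End DynaStep.

(** Balls of matrices are entrywise, and [nsq] dominates the square of each entry. *)
Lemma nsq_cvg0 (R : realType) (n k : nat) (W : nat -> 'M[R]_(n, k))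
    (l : 'M[R]_(n, k)) :
  nsq (W i - l) @[i --> \oo] --> 0 -> W @ \oo --> l.
Proof.
move=> W0; apply/cvg_ballP => eps eps0.
have /cvgr0Pnorm_lt /(_ (eps ^+ 2)) := W0.
rewrite exprn_gt0 // => /(_ isT); apply: filterS => i.
rewrite ger0_norm ?nsq_ge0 // => nW; split => // a b.
rewrite /ball /= -ltr_sqr ?nnegrE ?normr_ge0 ?ltW //.
rewrite real_normK ?num_real //; apply: le_lt_trans nW.
rewrite -sqrrN opprB; have := sqr_coord_le_nsq (W i - l) a b.
by rewrite !mxE.
Qed.

(** * Gradient Dyna as an instance, and the minimizer of the MB-MSPBE *)

Section GradientDynaLaw.
Context (R : realType) (m : nat) (X : {fset 'cV[R]_m}) (Act : finType).
Context (gamma : R) (xhat : X -> Act -> 'cV[R]_m) (rhat : X -> Act -> R).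
Context (zeta : X -> R) (pi : X -> Act -> R).

Lemma joint_pmf_is_pmf : is_pmf zeta -> (forall v, is_pmf (pi v)) ->
  is_pmf (joint_pmf zeta pi).
Proof.
move=> [zeta0 zeta1] hpi; split => [z|].
  by rewrite mulr_ge0 //; exact: (hpi _).1.
rewrite -(pair_bigA _ (fun v a => zeta v * pi v a)) /= -zeta1.
by apply: eq_bigr => v _; rewrite -mulr_sumr (hpi v).2 mulr1.
Qed.

Let f (z : X * Act) : 'cV[R]_m := val z.1.
Let g (z : X * Act) : 'cV[R]_m := gamma *: xhat z.1 z.2.
Let r (z : X * Act) : R := rhat z.1 z.2.

(** Exhibits the weight increment as affine in [w], the form used by [dyna_step]. *)
Lemma td_errorE (w : 'cV[R]_m) (z : X * Act) :
  td_error gamma xhat rhat w z.1 z.2 *: f z =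
  r z *: f z - f z *m (f z - g z)^T *m w.
Proof.
have dotE (u : 'rV[R]_m) : u *m w = ((w^T *m u^T) 0 0)%:M.
  by rewrite [u *m w]mx11_scalar -trmx_mul [in RHS]mxE.
rewrite -mulmxA dotE mul_mx_scalar -scalerBl; congr (_ *: _).
rewrite /td_error /dotv trmxK mulmxBr -scalemxAr !mxE opprB addrA.
by rewrite /r /f.
Qed.

Lemma gradient_dynaE (alpha beta : nat -> R) (phi : nat -> X) (a : nat -> Act)
    (w0 : 'cV[R]_m) (V0 : 'M[R]_m) (k : nat) :
  gradient_dyna gamma xhat rhat alpha beta phi a w0 V0 k.+1 =
  dyna_step f g r alpha beta k
    (gradient_dyna gamma xhat rhat alpha beta phi a w0 V0 k) (phi k, a k).
Proof.
rewrite [LHS]/=; case: gradient_dyna => w V.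
rewrite /dyna_step /= -(td_errorE w (phi k, a k)) trmx_mul trmxK.
congr (_, _ + _ *: (_ - _)).
by rewrite -mulNmx opprB.
Qed.

(** The iterate depends on the sample history alone, which transfers the estimates on the tree to
    it. *)
Lemma gradient_dyna_history (d : measure_display)
    (Omega : measurableType d) (phi : nat -> Omega -> X)
    (a : nat -> Omega -> Act) (alpha beta : nat -> R)
    (w0 : 'cV[R]_m) (V0 : 'M[R]_m) :
  exists st : seq (X * Act) -> 'cV[R]_m * 'M[R]_m,
    (forall h s, st (rcons h s) = dyna_step f g r alpha beta (size h) (st h) s)
    /\ forall omega k,
      gradient_dyna gamma xhat rhat alpha beta (phi^~ omega) (a^~ omega) w0 V0 k
      = st (history (fun k omega => (phi k omega, a k omega)) k omega).
Proof.
(* The fold carries the time, since the step sizes depend on it. *)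
pose next (kst : nat * ('cV[R]_m * 'M[R]_m)) s :=
  (kst.1.+1, dyna_step f g r alpha beta kst.1 kst.2 s).
pose run h := foldl next (0%N, (w0, V0)) h.
have run_rcons h s : run (rcons h s) = next (run h) s.
  by rewrite /run foldl_rcons.
have run1 h : (run h).1 = size h.
  elim/last_ind: h => [//|h s IHh].
  by rewrite run_rcons size_rcons /= IHh.
exists (fun h => (run h).2); split => [h s|omega k].
  by rewrite run_rcons /= run1.
elim: k => [//|k IHk].
by rewrite gradient_dynaE historyS run_rcons /= run1 size_history IHk.
Qed.

Hypothesis hzeta : is_pmf zeta.
Hypothesis hpi : forall v, is_pmf (pi v).
Hypothesis hsecond : second_moment zeta pi \in unitmx.
Hypothesis hA : A_matrix gamma xhat zeta pi \in unitmx.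

(** The objective is the quadratic form of the inverse second moment at [c - A *m w]; this form is
    positive definite, so the minimum [0] is reached exactly where [A *m w = c]. *)
Lemma MB_MSPBE_unique_minimizer :
  is_unique_minimizer (MB_MSPBE gamma xhat rhat zeta pi)
    (invmx (A_matrix gamma xhat zeta pi) *m c_vector rhat zeta pi).
Proof.
set A := A_matrix _ _ _ _; set c := c_vector _ _ _.
have p_pmf := joint_pmf_is_pmf hzeta hpi.
(* With the identity for [A], this is coercivity of the inverse second moment itself. *)
have [kappa kappa0] :=
  inv_second_moment_coercive p_pmf (f := f) hsecond (unitmx1 R m).
rewrite -/(second_moment zeta pi) trmx1 mul1mx mulmx1 => coer.
have MSPBE_E w : MB_MSPBE gamma xhat rhat zeta pi w =
    frob (c - A *m w) (invmx (second_moment zeta pi) *m (c - A *m w)).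
  rewrite /MB_MSPBE; have -> : expect zeta pi
      (fun v a => td_error gamma xhat rhat w v a *: val v) = c - A *m w.
    rewrite /expect; under eq_bigr do rewrite (td_errorE w) scalerBr.
    rewrite sumrB; congr (_ - _).
    by rewrite mulmx_suml; apply: eq_bigr => z _; rewrite scalemxAl.
  by rewrite frobC /frob mxtrace_mulC trace_mx11 mulmxA.
have at_wstar : MB_MSPBE gamma xhat rhat zeta pi (invmx A *m c) = 0.
  by rewrite MSPBE_E mulKVmx // subrr /frob mul0mx mxtrace0.
split => [w|w w_min].
  rewrite at_wstar MSPBE_E; apply: le_trans (coer _).
  by rewrite mulr_ge0 ?nsq_ge0 // ltW.
have := w_min (invmx A *m c); rewrite at_wstar MSPBE_E.
move=> /(le_trans (coer _)); rewrite pmulr_rle0 // => /nsq_eq0 /subr0_eq ->.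
by rewrite mulKmx.
Qed.

End GradientDynaLaw.

Theorem theorem6p1
  (R : realType) (m : nat) (S Act : finType) (x : S -> 'cV[R]_m) (gamma : R)
  (pi : feature_set x -> Act -> R) (zeta : feature_set x -> R)
  (xhat : feature_set x -> Act -> 'cV[R]_m) (rhat : feature_set x -> Act -> R)
  (d : measure_display) (Omega : measurableType d) (P : probability Omega R)
  (phi : nat -> Omega -> feature_set x) (A : nat -> Omega -> Act)
  (alpha beta : nat -> R) (V0 : 'M[R]_m)
  (hgamma : 0 <= gamma < 1)
  (hpi : forall v, is_pmf (pi v))
  (hzeta : is_pmf zeta)
  (hiid : iid_with_pmf P (joint_pmf zeta pi)
            (fun k omega => (phi k omega, A k omega)))
  (hbounded : forall omega, bounded_fun (fun k => val (phi k omega)))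
  (hsecond : second_moment zeta pi \in unitmx)
  (hA : A_matrix gamma xhat zeta pi \in unitmx)
  (halpha_gt0 : forall k, 0 < alpha k)
  (hbeta_gt0 : forall k, 0 < beta k)
  (halpha_sum : series alpha @ \oo --> +oo)
  (hbeta_sum : series beta @ \oo --> +oo)
  (halpha_sqr : cvgn (series (fun k => alpha k ^+ 2)))
  (hbeta_sqr : cvgn (series (fun k => beta k ^+ 2))) :
  let wstar := invmx (A_matrix gamma xhat zeta pi) *m c_vector rhat zeta pi in
  is_unique_minimizer (MB_MSPBE gamma xhat rhat zeta pi) wstar /\
  forall w0 : 'cV[R]_m,
    {ae P, forall omega,
      (fun k => (gradient_dyna gamma xhat rhat alpha beta (phi^~ omega)
                   (A^~ omega) w0 V0 k).1) @ \oo --> wstar}.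
Proof.
move=> wstar; split; first exact: MB_MSPBE_unique_minimizer.
move=> w0.
have [st [st_rcons stE]] :=
  gradient_dyna_history gamma xhat rhat phi A alpha beta w0 V0.
have p_pmf := joint_pmf_is_pmf hzeta hpi.
(* [second_moment], [A_matrix] and [c_vector] are convertible to the averages over [joint_pmf] used
   in the drift analysis. *)
have := dyna_w_ae halpha_gt0 hbeta_gt0 p_pmf hsecond hA hiid
  halpha_sum hbeta_sum halpha_sqr hbeta_sqr st_rcons.
apply: filterS => omega w_cvg; apply: nsq_cvg0.
by under eq_fun do rewrite stE.
Qed.
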